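(* Let $G$ be a simple connected graph with $p$ vertices and $q$ edges, and let $n$ be a positive integer. If $t=n$ and the subdivision graph $S(G)$ is integral, then $S(G)_t^n$ is integral.
   Context: A graph is integral if all eigenvalues of its adjacency matrix are integers. The subdivision graph $S(G)$ is obtained by inserting a new vertex into every edge of $G$; its vertex set is identified with $V(G)\cup E(G)$, with $v\in V(G)$ adjacent to $e\in E(G)$ iff $v$ is an endpoint of $e$. $S(G)_t^n$ ($n$ a positive integer, $t=n$ or $t=n-1$): start with $S(G)$. For each $v_j\in V(G)$ introduce $n$ new isolated vertices and join each to all neighbors of $v_j$ in $S(G)$. Then, for each vertex $e_j\in E(G)$ of $S(G)$, introduce $t$ new isolated vertices and join each to all neighbors of $e_j$ in the graph obtained so far (including the newly added copies of vertices of $G$). It has $(n+1)p+(t+1)q$ vertices and $2(t+1)(n+1)q$ edges. *)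

(* Defs.v *)
From mathcomp Require Import all_boot all_order all_algebra all_field.

Set Implicit Arguments.
Unset Strict Implicit.
Unset Printing Implicit Defensive.

Import GRing.Theory Num.Theory.
Local Open Scope ring_scope.

Record sgraph := SGraph {
  vertex :> finType;
  adj : rel vertex;
  adj_sym : symmetric adj;
  adj_irrefl : irreflexive adj }.

(* The graph without vertices is not regarded as connected. *)
Definition connected (G : sgraph) : Prop :=
  (0 < #|G|)%N /\ forall x y : G, connect (@adj G) x y.

Definition edges (G : sgraph) : {set {set G}} :=
  [set [set x; y] | x in G, y in G & adj x y].

Definition edge (G : sgraph) : finType := {e : {set G} | e \in edges G}.

Definition adjmx (G : sgraph) : 'M[algC]_#|G| :=
  \matrix_(i, j) (adj (enum_val i) (enum_val j))%:R.

Definition integral (G : sgraph) : Prop :=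
  forall a : algC, eigenvalue (adjmx G) a -> a \is a Num.int.

Section Subdivision.
Variable G : sgraph.

Definition subdiv_adj : rel (G + edge G)%type := fun a b =>
  match a, b with
  | inl v, inr e => v \in val e
  | inr e, inl v => v \in val e
  | _, _ => false
  end.

Lemma subdiv_adj_sym : symmetric subdiv_adj.
Proof. by case=> [x|x] [y|y]. Qed.

Lemma subdiv_adj_irrefl : irreflexive subdiv_adj.
Proof. by case. Qed.

Definition subdivision : sgraph := SGraph subdiv_adj_sym subdiv_adj_irrefl.

End Subdivision.

Section AddCopies.
Variables (H : sgraph) (I : finType) (f : I -> H) (m : nat).

(* [inr (i, k)] is the k-th of the m new vertices attached to [f i]: its
   neighbours are those of [f i] in [H], and no two new vertices are adjacent. *)
Definition copies_adj : rel (H + I * 'I_m)%type := fun a b =>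
  match a, b with
  | inl x, inl y => adj x y
  | inl x, inr (i, _) => adj x (f i)
  | inr (i, _), inl y => adj (f i) y
  | inr _, inr _ => false
  end.

Lemma copies_adj_sym : symmetric copies_adj.
Proof. by case=> [x|[i k]] [y|[j l]] //=; rewrite adj_sym. Qed.

Lemma copies_adj_irrefl : irreflexive copies_adj.
Proof. by case=> [x|[i k]] //=; rewrite adj_irrefl. Qed.

Definition add_copies : sgraph := SGraph copies_adj_sym copies_adj_irrefl.

End AddCopies.

Section SubdivisionCopies.
Variables (G : sgraph) (n t : nat).

Definition copy_vertices : sgraph :=
  @add_copies (subdivision G) G (fun v => inl v) n.

(* S(G)_t^n *)
Definition subdivision_copies : sgraph :=
  @add_copies copy_vertices (edge G) (fun e => inl (inr e)) t.

End SubdivisionCopies.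

(* Main.v *)
Require Import Defs.
From mathcomp Require Import all_boot all_order all_algebra all_field.

(** For [t = n] the graph S(G)_n^n is a balanced blow-up of S(G): sending
    every new vertex to the vertex that it copies, and fixing the old ones,
    gives a map onto S(G) which preserves and reflects adjacency
    ([adj_subdivision_source]).  In general its fibres have [n.+1] elements
    over V(G) and [t.+1] over E(G); for [t = n] they all have the same size
    ([card_subdivision_copies_fiber]).

    If K is a blow-up of H with fibres of size [m] and [v] is an eigenvector of
    K for the eigenvalue [a], summing [v] over the fibres gives a vector [w] on
    H with [a w = m (w A)], where [A] is the adjacency matrix of H.  When
    [a != 0], the entries of [v] are recovered from [w], so [w] is nonzero and
    [a / m] is an eigenvalue of H.  Hence every eigenvalue of K is 0 or [m]
    times an eigenvalue of H, and integrality passes from H to K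
    ([integral_blowup]). *)

Set Implicit Arguments.
Unset Strict Implicit.
Unset Printing Implicit Defensive.

Import GRing.Theory Num.Theory.
Local Open Scope ring_scope.

(** Indexing by vertices instead of by their ranks in the enumeration lets
    sums be regrouped along maps between vertex sets. *)
Lemma eigenvalue_adjmxP (G : sgraph) (a : algC) :
  reflect
    (exists2 v : G -> algC, exists x, v x != 0 &
       forall y, \sum_x v x * (adj x y)%:R = a * v y)
    (eigenvalue (adjmx G) a).
Proof.
apply: (iffP eigenvalueP) => [[r rA rN0] | [v [x0 vx0] vA]].
- exists (fun x => r 0 (enum_rank x)).
    case/rV0Pn: rN0 => i ri; exists (enum_val i); by rewrite enum_valK.
  move=> y; have /rowP/(_ (enum_rank y)) := rA; rewrite !mxE => <-.
  rewrite (reindex (@enum_val _ (mem G))) /=; last exact/onW_bij/enum_val_bij.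
  by apply: eq_bigr => i _; rewrite !mxE enum_valK enum_rankK.
- exists (\row_i v (enum_val i)); last first.
    by apply/rV0Pn; exists (enum_rank x0); rewrite mxE enum_rankK.
  apply/rowP => j; rewrite !mxE -vA.
  rewrite (reindex (@enum_val _ (mem G))) /=; last exact/onW_bij/enum_val_bij.
  by apply: eq_bigr => i _; rewrite !mxE.
Qed.

Lemma integral_blowup (H K : sgraph) (pi : K -> H) (m : nat) :
    (forall x y, adj x y = adj (pi x) (pi y)) ->
    (forall s, #|[pred x | pi x == s]| = m) ->
  integral H -> integral K.
Proof.
move=> adj_pi card_fiber intH a /eigenvalue_adjmxP[v [x0 vx0] vA].
have [->|aN0] := eqVneq a 0; first exact: rpred0.
have mN0 : m%:R != 0 :> algC.
  rewrite pnatr_eq0 -(card_fiber (pi x0)) -lt0n.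
  by apply/card_gt0P; exists x0; rewrite inE.
pose w s := \sum_(x | pi x == s) v x.
have wA y : \sum_s w s * (adj s (pi y))%:R = a * v y.
  rewrite -vA (partition_big pi predT) //=; apply: eq_bigr => s _.
  rewrite mulr_suml; apply: eq_bigr => x /eqP <-.
  by rewrite adj_pi.
rewrite -(divfK mN0 a); apply: rpredM; last exact: natr_int.
apply/intH/eigenvalue_adjmxP; exists w.
  have [/existsP //|/existsPn w0] := boolP [exists s, w s != 0].
  case/negP: vx0; rewrite -(mulrI_eq0 _ (mulfI aN0)) -wA big1 // => s _.
  by have /negbNE/eqP -> := w0 s; rewrite mul0r.
move=> r; apply: (mulfI mN0); rewrite [RHS]mulrA [m%:R * (_ / _)]mulrC divfK //.
(* [wA], summed over the [m] vertices [y] of the fibre of [r]. *)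
rewrite [RHS]mulr_sumr -[RHS](eq_bigr _ (fun y _ => wA y)).
rewrite (eq_bigr (fun=> \sum_s w s * (adj s r)%:R)) => [|y /eqP -> //].
by rewrite sumr_const card_fiber mulr_natl.
Qed.

Section CopySource.
Variables (H : sgraph) (I : finType) (f : I -> H) (m : nat).

Definition copy_source (x : add_copies f m) : H :=
  match x with inl y => y | inr (i, _) => f i end.

(** New vertices are pairwise non-adjacent, so the copied vertices have to be
    pairwise non-adjacent for the copies to be faithful. *)
Lemma adj_copy_source :
    (forall i j, adj (f i) (f j) = false) ->
  forall x y, adj x y = adj (copy_source x) (copy_source y).
Proof. by move=> indep [x|[i k]] [y|[j l]] //=; rewrite indep. Qed.

Lemma card_copy_source_fiber (T : eqType) (g : H -> T) (s : T) :
  (#|[pred x | g (copy_source x) == s]|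
     = #|[pred y | g y == s]| + #|[pred i | g (f i) == s]| * m)%N.
Proof.
rewrite -!sum1_card big_sumType /=; congr (_ + _)%N.
rewrite big_distrl /= -[m in RHS]card_ord -sum1_card.
under [RHS]eq_bigr do rewrite mul1n.
by rewrite pair_big; apply: eq_big => [[i k]|//]; rewrite !inE andbT.
Qed.

End CopySource.

Section SubdivisionCopiesFibers.
Variables (G : sgraph) (n : nat).

Definition subdivision_source (x : subdivision_copies G n n) : subdivision G :=
  copy_source (copy_source x).

Lemma adj_subdivision_source x y :
  adj x y = adj (subdivision_source x) (subdivision_source y).
Proof. by rewrite adj_copy_source // adj_copy_source. Qed.

Lemma card_subdivision_copies_fiber s :
  #|[pred x | subdivision_source x == s]| = n.+1.
Proof.
rewrite (card_copy_source_fiber _ _ (@copy_source _ _ _ n)).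
rewrite (card_copy_source_fiber _ _ id) card1 /=.
case: s => [v|e].
  rewrite (eq_card (B := pred1 v)) ?card1 // mul1n.
  by rewrite (eq_card0 (A := [pred e | inr e == inl v])) // addn0.
rewrite (eq_card0 (A := [pred v | inl v == inr e])) // addn0.
by rewrite (eq_card (B := pred1 e)) ?card1 // mul1n.
Qed.

End SubdivisionCopiesFibers.

Theorem corollary3p9 (G : sgraph) (p q n t : nat)
  (hG : connected G) (hp : #|G| = p) (hq : #|edges G| = q)
  (hn : (0 < n)%N) (ht : t = n)
  (hS : integral (subdivision G)) :
  integral (subdivision_copies G n t).
Proof.
rewrite ht; apply: integral_blowup hS.
- exact: adj_subdivision_source.
- exact: card_subdivision_copies_fiber.
Qed.
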